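(* Let $\Omega\subseteq\mathbb{C}^n$ be a $d$-balanced, convex domain, where $d=(d_1,\dots,d_n)$, with $d$-Minkowski function $h_{d,\Omega}$. Then for all $z,w\in\mathbb{C}^n$ and all $\alpha\in[0,1]$, $$h_{d,\Omega}(\alpha z+(1-\alpha)w)\leq h_{d,\Omega}(z)+h_{d,\Omega}(w).$$
   Context: Let $n\geq 2$ and let $d=(d_1,\dots,d_n)$ be an $n$-tuple of positive integers. A domain $\Omega\subseteq\mathbb{C}^n$ is $d$-balanced if for each $z=(z_1,\dots,z_n)\in\Omega$ and each $\lambda\in\mathbb{C}$ with $|\lambda|\leq 1$ one has $(\lambda^{d_1}z_1,\dots,\lambda^{d_n}z_n)\in\Omega$. Its $d$-Minkowski function on $\mathbb{C}^n$ is $$h_{d,\Omega}(z):=\inf\left\{t>0:\left(\frac{z_1}{t^{d_1}},\dots,\frac{z_n}{t^{d_n}}\right)\in\Omega\right\}.$$ *)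

(* Defs.v *)
From HB Require Import structures.
From mathcomp Require Import all_boot all_order all_algebra.
From mathcomp Require Import complex.
From mathcomp Require Import all_classical all_reals all_analysis.

Set Implicit Arguments.
Unset Strict Implicit.
Unset Printing Implicit Defensive.

Import Order.TTheory GRing.Theory Num.Theory numFieldNormedType.Exports.

Local Open Scope classical_set_scope.
Local Open Scope ring_scope.
Local Open Scope complex_scope.

(* [R[i]] carries no topology by default; this transports the one given by the
   modulus, so that ['rV[R[i]]_n] gets the product (Euclidean) topology. *)
HB.instance Definition _ (R : realType) := NormedModule.copy R[i] R[i]^o.

(* The order of [R[i]] makes only real numbers comparable with 0 and 1, so the
   coefficients in [convex_set Omega], for [Omega : set 'rV[R[i]]_n], range over
   the real unit interval, as in the usual notion of convexity. *)

Definition domain (T : topologicalType) (Omega : set T) : Prop :=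
  [/\ Omega !=set0, open Omega & connected Omega].

Definition d_balanced (R : realType) (n : nat) (d : 'I_n -> nat)
    (Omega : set 'rV[R[i]]_n) : Prop :=
  forall (z : 'rV[R[i]]_n) (lambda : R[i]), Omega z -> `|lambda| <= 1 ->
    Omega (\row_j (lambda ^+ d j * z ord0 j)).

(* [inf] is real-valued: when [Omega] is a neighbourhood of 0 and all [d j] are
   positive, the set below is nonempty (and it is bounded below by 0). *)
Definition d_minkowski (R : realType) (n : nat) (d : 'I_n -> nat)
    (Omega : set 'rV[R[i]]_n) (z : 'rV[R[i]]_n) : R :=
  inf [set t : R | 0 < t /\ Omega (\row_j (z ord0 j / t%:C ^+ d j))].

(* Main.v *)
Require Import Defs.
From mathcomp Require Import all_boot all_order all_algebra.
From mathcomp Require Import complex.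
From mathcomp Require Import all_classical all_reals all_analysis.

Import Order.TTheory GRing.Theory Num.Theory numFieldNormedType.Exports.

Local Open Scope classical_set_scope.
Local Open Scope ring_scope.
Local Open Scope complex_scope.

(** If [s] and [t] are admissible in the infima defining [h z] and [h w], then
    balancedness makes the larger dilation [s + t] admissible for both, and
    convexity makes it admissible for any convex combination of [z] and [w]. *)

Definition admissible_dilations (R : realType) (n : nat) (d : 'I_n -> nat)
    (Omega : set 'rV[R[i]]_n) (z : 'rV[R[i]]_n) : set R :=
  [set t : R | 0 < t /\ Omega (\row_j (z ord0 j / t%:C ^+ d j))].

Section AdmissibleDilations.
Variables (R : realType) (n : nat) (d : 'I_n -> nat) (Omega : set 'rV[R[i]]_n).
Implicit Types (z w : 'rV[R[i]]_n) (s t alpha : R).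

Local Notation adm := (admissible_dilations R n d Omega).

(** Take [lambda = 0] in balancedness: as each [d j] is positive, every coordinate is multiplied by
    0. *)
Lemma d_balanced_mem0 :
  (forall j, (0 < d j)%N) -> Omega !=set0 -> d_balanced d Omega -> Omega 0.
Proof.
move=> d_gt0 [z Oz] /(_ z 0 Oz); rewrite normr0 => /(_ ler01).
rewrite (_ : \row_j _ = 0)//; apply/rowP => j.
by rewrite !mxE expr0n eqn0Ngt d_gt0 mul0r.
Qed.

(** A large dilation contracts [z] into a ball around 0 inside [Omega]. Nonemptiness is what lets a
    lower bound of the set pass to its infimum. *)
Lemma admissible_dilations_nonempty z : (forall j, (0 < d j)%N) ->
  nbhs (0 : 'rV[R[i]]_n) Omega -> adm z !=set0.
Proof.
move=> d_gt0 /nbhs_ballP[/= eC eC_gt0 eO].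
(* The radius comes as an element of [R[i]]; being positive, it is real. *)
have /complex_realP[e eCE] : eC \is Num.real by exact: gtr0_real.
rewrite {}eCE in eC_gt0 eO; move: eC_gt0; rewrite (ltcR 0) => e_gt0.
have [a zE] : exists a : 'I_n -> R, forall j, `|z ord0 j| = (a j)%:C.
  by exists (fun j => complex.Re `|z ord0 j|) => j; rewrite RRe_real ?normr_real.
have a_ge0 j : 0 <= a j by rewrite -(lecR 0) -zE normr_ge0.
(* The sum makes [t] exceed each [a j / e]; the summand 1 makes this strict and gives
   [t <= t ^+ d j]. *)
pose t : R := 1 + \sum_j a j / e.
have t_ge1 : 1 <= t by rewrite lerDl sumr_ge0// => j _; rewrite divr_ge0// ltW.
have t_gt0 : 0 < t by exact: lt_le_trans t_ge1.
exists t; split=> //; apply: eO; split=> [|i j]; first by rewrite (ltcR 0).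
rewrite -ball_normE/= !mxE sub0r normrN normrM normfV normrX.
rewrite zE (@ger0_norm _ t%:C) ?(lecR 0) ?ltW//.
have -> : (a j)%:C / t%:C ^+ d j = (a j / t ^+ d j)%:C.
  by rewrite rmorphM fmorphV rmorphXn.
rewrite ltcR ltr_pdivrMr ?exprn_gt0//.
apply: (@lt_le_trans _ _ (e * t)); last first.
  by rewrite ler_pM2l// -{1}(expr1 t) ler_weXn2l// d_gt0.
rewrite mulrC -ltr_pdivrMr// /t (bigD1 j)//= addrA addrAC ltrDr.
by rewrite ltr_pwDl// sumr_ge0// => k _; rewrite divr_ge0// ltW.
Qed.

(** Balancedness with [lambda = s / t], of modulus at most 1, turns the factor [1 / s ^+ d j] into
    [1 / t ^+ d j]. *)
Lemma admissible_dilations_le z s t :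
  d_balanced d Omega -> s <= t -> adm z s -> adm z t.
Proof.
move=> Obal s_le_t [s_gt0 Os]; have t_gt0 := lt_le_trans s_gt0 s_le_t.
split=> //; have st_le1 : `|(s / t)%:C| <= 1%:C.
  rewrite ger0_norm; first by rewrite lecR ler_pdivrMr// mul1r.
  by rewrite (lecR 0) divr_ge0 ?ltW.
have := Obal _ _ Os st_le1.
congr Omega; apply/rowP => j; rewrite !mxE rmorphM fmorphV expr_div_n.
rewrite [LHS]mulrC mulrA divfK// expf_neq0//.
by rewrite (fmorph_eq0 (real_complex R)) gt_eqF.
Qed.

(** For a fixed [t] the dilation is linear in the point, so it commutes with convex combinations. *)
Lemma admissible_dilations_conv z w t alpha :
  convex_set Omega -> 0 <= alpha <= 1 -> adm z t -> adm w t ->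
  adm (alpha%:C *: z + (1 - alpha)%:C *: w) t.
Proof.
move=> Ocvx /andP[a_ge0 a_le1] [t_gt0 Oz] [_ Ow]; split=> //.
have ac_ge0 : 0 <= alpha%:C by rewrite (lecR 0).
have ac_le1 : alpha%:C <= 1%:C by rewrite lecR.
have := Ocvx _ _ (Itv01 ac_ge0 ac_le1) (mem_set Oz) (mem_set Ow).
rewrite inE; congr Omega; apply/rowP => j; rewrite !mxE/=.
have -> : (1 - alpha)%:C = unstable.onem alpha%:C by rewrite rmorphB.
by rewrite [RHS]mulrDl !mulrA.
Qed.

End AdmissibleDilations.

Theorem proposition3p2 (R : realType) (n : nat) (d : 'I_n -> nat)
    (Omega : set 'rV[R[i]]_n)
    (hn : (2 <= n)%N) (hd : forall j, (0 < d j)%N)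
    (hdom : domain Omega) (hbal : d_balanced d Omega)
    (hconv : convex_set Omega)
    (z w : 'rV[R[i]]_n) (alpha : R) (halpha : 0 <= alpha <= 1) :
  d_minkowski d Omega (alpha%:C *: z + (1 - alpha)%:C *: w)
    <= d_minkowski d Omega z + d_minkowski d Omega w.
Proof.
case: hdom => O_neq0 O_open _.
have O_nbhs0 : nbhs (0 : 'rV[R[i]]_n) Omega.
  by apply: open_nbhs_nbhs; split=> //; exact: d_balanced_mem0 O_neq0 hbal.
have adm_lb v : lbound (admissible_dilations R n d Omega v) 0.
  by move=> t [/ltW].
have adm_neq0 v := admissible_dilations_nonempty R n d Omega v hd O_nbhs0.
(* Isolating one infimum at a time reduces the claim to the bound [s + t] for all admissible [s] and
   [t]. *)
rewrite -lerBlDr; apply: lb_le_inf; [exact: adm_neq0|move=> s adm_s].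
rewrite lerBlDr -lerBlDl; apply: lb_le_inf; [exact: adm_neq0|move=> t adm_t].
(* It suffices that [s + t] is itself admissible for the convex combination. *)
rewrite lerBlDl; apply: ge_inf; first by exists 0; exact: adm_lb.
apply: admissible_dilations_conv => //.
- by apply: admissible_dilations_le adm_s => //; rewrite lerDl; case: adm_t => /ltW.
- by apply: admissible_dilations_le adm_t => //; rewrite lerDr; case: adm_s => /ltW.
Qed.
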